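(* Let $n$ and $k$ be positive integers with $n>2k$, and let $j\geqslant 0$ be the integer such that $2^j\leqslant k<2^{j+1}$. Let $Y_k=S_k\times S_{n-k}$ be the subgroup of the symmetric group $S_n$ in which the factor $S_k$ permutes $\{1,\ldots,k\}$ and the factor $S_{n-k}$ permutes $\{k+1,\ldots,n\}$. Let $x\in S_n$ and let $X=x^{S_n}$ be the conjugacy class of $x$ in $S_n$. Then there exists a positive integer $r$ such that $r S_n=X\boldsymbol{\cdot}Y_k$ if and only if the cycle type of $x$ (counting fixed points as cycles of length $1$) has exactly one cycle of length $2^i$ for each $0\leqslant i\leqslant j$, and all other cycles of $x$ have length at least $k+1$.
   Context: For subsets $A,B$ of a finite group $G$ and a positive integer $r$, one writes $rG=A\boldsymbol{\cdot}B$ if for every $g\in G$ there are precisely $r$ pairs $(a,b)\in A\times B$ with $g=ab$ (in which case $B$ is called a code in $G$ with respect to $A$). *)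

(* Defs.v *)
From mathcomp Require Import all_boot all_fingroup.

Set Implicit Arguments.
Unset Strict Implicit.
Unset Printing Implicit Defensive.

Import GroupScope.

(* r G = A . B, where G is the group of all elements of gT.
   For permutations (a * b) i = b (a i); with A closed under conjugation and B a
   subgroup, composing in the other order gives an equivalent condition. *)
Definition fold_factorization (gT : finGroupType) (r : nat) (A B : {set gT}) :
  Prop :=
  forall g : gT, #|[set ab in setX A B | g == ab.1 * ab.2]| = r.

(* Points are numbered from 0, so {1, ..., k} is [set i | i < k].
   Sym A is the set of permutations that fix every point outside A. *)
Definition young (n k : nat) : {set 'S_n} :=
  Sym [set i : 'I_n | i < k] * Sym [set i : 'I_n | k <= i].

(* porbits s contains the singletons of the fixed points of s. *)
Definition cycle_type (T : finType) (s : {perm T}) : seq nat :=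
  sort geq [seq #|C| | C : {set T} in porbits s].

(* Main.v *)
Require Import Defs.
From mathcomp Require Import all_boot all_fingroup all_algebra.
From mathcomp Require Import zify.

(* Counting factorizations of g through [X] and the Young subgroup shows that the
   condition says: x' @: A is uniformly distributed over the k-subsets, for x'
   uniform in the class X of x and A any k-subset.  Let M_k(A, B) be the number
   of x' in X with x' @: A = B, which is invariant under simultaneous
   permutations of A and B.  Double counting gives
     sum_(c in B) M_k(A, B - c) = sum_(a notin A) M_(k+1)(A + a, B)
   for |A| = k and |B| = k + 1.  By induction on |A :&: B|, it shows that M_(k+1)
   constant implies M_k constant (upwards, using 2k < n), and that M_k constant
   implies M_(k+1) constant (downwards) once the diagonal of M_(k+1) has the right
   value, that is, once x fixes exactly one (k+1)-subset.  Hence the condition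
   holds iff x fixes exactly one i-subset for every i <= k.
   The number of fixed i-subsets is the coefficient of 'X^i in the product of
   1 + 'X^l over the cycle lengths l.  These are 1 up to degree k iff the lengths
   at most k are 1, 2, 4, ..., each once: if this is so below m, the cycles shorter
   than m contribute 1 to the coefficient of 'X^m, or 0 when m is a power of 2. *)

Set Implicit Arguments.
Unset Strict Implicit.
Unset Printing Implicit Defensive.

Import GRing.Theory.

(** * Images of a set under a conjugacy class *)

Lemma imset_permM (T : finType) (s t : {perm T}) (A : {set T}) :
  (s * t)%g @: A = t @: (s @: A).
Proof. by rewrite -imset_comp; apply: eq_imset => i; rewrite /= permM. Qed.

Lemma imset_perm1 (T : finType) (A : {set T}) : (1 : {perm T})%g @: A = A.
Proof. by under eq_imset do rewrite perm1; rewrite imset_id. Qed.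

Lemma imset_perm_eq (T : finType) (s : {perm T}) (A B : {set T}) :
  (s^-1%g @: A == B) = (A == s @: B).
Proof.
by apply/eqP/eqP=> [<-|->]; rewrite -imset_permM ?mulVg ?mulgV imset_perm1.
Qed.

Lemma imset_tperm_id (T : finType) (a b : T) (A : {set T}) :
  (a \in A) = (b \in A) -> tperm a b @: A = A.
Proof.
move=> eqab; apply/eqP; rewrite eqEcard card_imset ?leqnn ?andbT; last exact: perm_inj.
apply/subsetP=> _ /imsetP[c Ac ->].
by case: tpermP Ac => [->|->|_ _ //]; rewrite eqab.
Qed.

(** Transposing a point of [A :\: B] with a point of [B :\: A] removes one point from [A :\: B];
    iterate. *)
Lemma perm_transitive_sets (T : finType) (A B : {set T}) :
  #|A| = #|B| -> exists s : {perm T}, s @: A = B.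
Proof.
move: {2}#|A :\: B| (erefl #|A :\: B|) => t.
elim: t A => [|t IH] A cardAB eqAB.
  exists 1%g; rewrite imset_perm1.
  apply/eqP; rewrite eqEcard eqAB leqnn andbT -setD_eq0 -cards_eq0.
  by rewrite cardAB.
have /card_gt0P[a /setDP[Aa Ba]] : 0 < #|A :\: B| by rewrite cardAB.
have /card_gt0P[b /setDP[Bb Ab]] : 0 < #|B :\: A|.
  have := cardsID A B; have := cardsID B A; rewrite setIC; lia.
have tA : tperm a b @: A = b |: A :\ a.
  rewrite -{1}(setD1K Aa) imsetU1 tpermL imset_tperm_id //.
  by rewrite !inE eqxx (negbTE Ab) andbF.
have tAB : (tperm a b @: A) :\: B = (A :\: B) :\ a.
  rewrite tA; apply/setP=> c; rewrite !inE.
  by case: (eqVneq c b) => [->|]; rewrite ?Bb /= ?andbF // andbCA.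
have [||s sE] := IH (tperm a b @: A).
- by move: cardAB; rewrite tAB (cardsD1 a (A :\: B)) !inE Aa Ba => -[].
- by rewrite card_imset //; exact: perm_inj.
by exists (tperm a b * s)%g; rewrite imset_permM.
Qed.

Definition transport (T : finType) (X : {set {perm T}}) (A B : {set T}) :=
  #|[set a in X | a @: A == B]|.

Definition fixed_sets (T : finType) (x : {perm T}) (k : nat) :=
  #|[set A : {set T} | (#|A| == k) && (x @: A == A)]|.

(** A constant value can only be [#|X| / 'C(#|T|, k)]; the product form avoids the division. *)
Definition equidistributed (T : finType) (X : {set {perm T}}) (k : nat) :=
  forall A B : {set T}, #|A| = k -> #|B| = k ->
    transport X A B * 'C(#|T|, k) = #|X|.

Lemma transportE (T : finType) (X : {set {perm T}}) (A B : {set T}) :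
  transport X A B = \sum_(a in X) (a @: A == B).
Proof.
rewrite /transport -sum1_card big_mkcond [RHS]big_mkcond /=.
by apply: eq_bigr => a _; rewrite inE; case: (a \in X) => //=; case: (_ == _).
Qed.

Lemma transport_conj (T : finType) (X : {set {perm T}}) (g : {perm T})
    (A B : {set T}) :
  [set: {perm T}] \subset 'N(X)%g ->
  transport X (g @: A) (g @: B) = transport X A B.
Proof.
move=> normX; rewrite /transport -[RHS](cardJg _ g); congr #|pred_of_set _|.
apply/setP=> a; rewrite mem_conjg !inE memJ_norm ?(subsetP normX) ?inE //.
by rewrite conjgE invgK !imset_permM imset_perm_eq.
Qed.

(** Conjugating by a transposition that stabilizes [A] moves only the other set. *)
Lemma transport_tperm (T : finType) (X : {set {perm T}}) (a b : T)
    (A B : {set T}) :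
    [set: {perm T}] \subset 'N(X)%g -> (a \in A) = (b \in A) ->
  transport X (tperm a b @: B) A = transport X B A /\
  transport X A (tperm a b @: B) = transport X A B.
Proof.
move=> normX eqab; split; rewrite -[X in X = _](transport_conj (tperm a b)) //;
  by rewrite -imset_permM tperm2 imset_perm1 imset_tperm_id.
Qed.

(* Both sides count the pairs of an element [x] of [X] and a point [c] outside
   [x @: A] with [c |: x @: A = B]. *)
Lemma sum_transport_shift (T : finType) (X : {set {perm T}}) (A B : {set T}) :
  \sum_(c in B) transport X A (B :\ c) =
  \sum_(a in ~: A) transport X (a |: A) B.
Proof.
under eq_bigr do rewrite transportE; rewrite exchange_big /=.
under [RHS]eq_bigr do rewrite transportE; rewrite [RHS]exchange_big /=.
apply: eq_bigr => x _; rewrite [RHS](reindex_inj (@perm_inj _ x^-1%g)) /=.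
rewrite big_mkcond [RHS]big_mkcond /=; apply: eq_bigr => c _.
rewrite imsetU1 permKV in_setC.
have -> : (x^-1%g c \in A) = (c \in x @: A).
  by rewrite -{2}[c](permKV x) mem_imset //; exact: perm_inj.
have [Bc|nBc] := boolP (c \in B); have [Dc|nDc] := boolP (c \in x @: A) => //=.
- by case: eqP Dc => // ->; rewrite !inE eqxx.
- congr (nat_of_bool _); apply/eqP/eqP=> [->|<-]; first exact: setD1K.
  by rewrite setU1K.
- by case: eqP nBc => // <-; rewrite !inE eqxx.
Qed.

(** Double count of the pairs of a conjugate of [x] and a [k]-subset it fixes: all conjugates fix
    equally many. *)
Lemma sum_transport_diag (T : finType) (x : {perm T}) (k : nat) :
  \sum_(A : {set T} | #|A| == k) transport (x ^: [set: {perm T}])%g A A =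
  #|(x ^: [set: {perm T}])%g| * fixed_sets x k.
Proof.
under eq_bigr do rewrite transportE; rewrite exchange_big /=.
rewrite -sum_nat_const; apply: eq_bigr => _ /imsetP[g _ ->].
rewrite /fixed_sets -sum1_card big_mkcond [RHS]big_mkcond /=.
rewrite (reindex_inj (imset_inj (@perm_inj _ g))) /=; apply: eq_bigr => A _.
rewrite card_imset; last exact: perm_inj.
rewrite !inE -!imset_permM -conjgC imset_permM (inj_eq (imset_inj _)) //.
  by case: (#|A| == k) => //=; case: (_ == _).
exact: perm_inj.
Qed.

Lemma equidistributed0 (T : finType) (X : {set {perm T}}) : equidistributed X 0.
Proof.
move=> A B /cards0_eq -> /cards0_eq ->; rewrite bin0 muln1 /transport.
by congr #|pred_of_set _|; apply/setP=> a; rewrite inE imset0 eqxx andbT.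
Qed.

Lemma equidistributed_pred (T : finType) (X : {set {perm T}}) (k : nat) :
    [set: {perm T}] \subset 'N(X)%g -> k.*2 < #|T| ->
  equidistributed X k.+1 -> equidistributed X k.
Proof.
move=> normX ltkT eqX A B; have [s] := ubnP #|A :&: B|.
elim: s => // s IH in A B * => leAB cardA cardB.
(* Since [2k < #|T|], some point [b] avoids both sets. Shifting with [b |: B] leaves
   [transport X A B] as the only unknown. *)
have /card_gt0P[b] : 0 < #|~: (A :|: B)|.
  by have := cardsC (A :|: B); have := cardsUI A B; rewrite cardA cardB; lia.
rewrite !inE negb_or => /andP[nAb nBb].
pose B' := b |: B; have cardB' : #|B'| = k.+1 by rewrite cardsU1 nBb cardB.
have cardB'D c : c \in B' -> #|B' :\ c| = k.
  by move=> B'c; have := cardsD1 c B'; rewrite B'c cardB' => -[].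
have sumR : (\sum_(a in ~: A) transport X (a |: A) B') * 'C(#|T|, k.+1) =
    (#|T| - k) * #|X|.
  have <- : #|~: A| = #|T| - k by rewrite cardsCs setCK cardA.
  rewrite big_distrl /= -sum_nat_const; apply: eq_bigr => a.
  by rewrite inE => nAa; rewrite eqX // cardsU1 nAa cardA.
(* Removing a [c] in [A] shrinks the intersection with [A], so induction applies. For [c] outside
   [A], transposing [b] and [c] preserves [A] and turns [B' :\ c] into [B]. *)
have sumL : (\sum_(c in B') transport X A (B' :\ c)) * 'C(#|T|, k) =
    #|A :&: B| * #|X| + (k.+1 - #|A :&: B|) * (transport X A B * 'C(#|T|, k)).
  have eqAB' : B' :&: A = A :&: B.
    by rewrite setIC setIUr (disjoint_setI0 (_ : [disjoint A & [set b]])) ?set0U //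
      disjoint_sym disjoints1.
  rewrite big_distrl (big_setID A) /= eqAB'; congr (_ + _).
    rewrite -sum_nat_const; apply: eq_bigr => c; rewrite !inE => /andP[Ac Bc].
    have B'c : c \in B' by rewrite !inE Bc orbT.
    apply: IH; rewrite ?cardB'D //; rewrite ltnS in leAB; apply: leq_trans leAB.
    apply: proper_card; apply/properP; split.
      by rewrite -eqAB' setIC setSI // subsetDl.
    by exists c; rewrite !inE ?Ac // eqxx.
  rewrite -eqAB' -cardB' -cardsD -sum_nat_const; apply: eq_bigr => c.
  rewrite inE => /andP[nAc B'c]; congr (_ * _).
  have eqA : (b \in A) = (c \in A) by rewrite (negbTE nAb) (negbTE nAc).
  have [_ <-] := transport_tperm (B' :\ c) normX eqA.
  congr transport; rewrite (can2_imset_pre _ (tpermK _ _) (tpermK _ _)).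
  apply/setP=> d; move: B'c; rewrite !inE.
  case: tpermP => [->|->|/eqP/negbTE -> /eqP/negbTE -> //].
    by rewrite eqxx (negbTE nBb).
  by rewrite eqxx [b == c]eq_sym; case: eqVneq => [->|]; rewrite ?(negbTE nBb).
(* This binomial identity makes the two totals agree; as [#|A :&: B| <= k], the unknown has a
   positive coefficient and can be solved for. *)
have := mul_bin_left #|T| k; have := sum_transport_shift X A B'.
have : 0 < 'C(#|T|, k.+1) by rewrite bin_gt0; lia.
have : #|A :&: B| <= k by rewrite -cardA subset_leq_card // subsetIl.
move: sumL sumR; set S := \sum_(c in B') _; set Y := transport X A B * _.
move=> + + le_tk Cgt0 eqS; rewrite -eqS => sumL sumR eqC.
have : (#|A :&: B| * #|X| + (k.+1 - #|A :&: B|) * Y) * 'C(#|T|, k.+1) =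
    k.+1 * #|X| * 'C(#|T|, k.+1).
  by rewrite -sumL mulnAC sumR mulnAC -eqC mulnAC.
move/eqP; rewrite eqn_pmul2r // => /eqP.
rewrite -{2}(subnKC (leqW le_tk)) mulnDl => /addnI/eqP.
by rewrite eqn_pmul2l ?subn_gt0 // => /eqP.
Qed.

Lemma equidistributed_succ (T : finType) (x : {perm T}) (k : nat) :
    equidistributed (x ^: [set: {perm T}])%g k -> fixed_sets x k.+1 = 1 ->
  equidistributed (x ^: [set: {perm T}])%g k.+1.
Proof.
set X := (x ^: _)%g => eqX fix1.
have normX : [set: {perm T}] \subset 'N(X)%g by exact: class_norm.
pose n := #|T|.
(* Diagonal entries are all equal by transitivity on [k.+1]-subsets, and [fix1] makes their sum
   [#|X|]. *)
have diag (A : {set T}) : #|A| = k.+1 -> transport X A A * 'C(n, k.+1) = #|X|.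
  move=> cardA; have := sum_transport_diag x k.+1; rewrite fix1 muln1 => <-.
  rewrite (eq_bigr (fun=> transport X A A)); last first.
    move=> B /eqP cardB.
    have [|s <-] := @perm_transitive_sets _ A B; first by rewrite cardA.
    by rewrite transport_conj.
  by rewrite sum_nat_const mulnC -card_draws cardsE.
move=> A B; have [s] := ubnP #|A :\: B|; elim: s => // s IH in A * => leAB cardA cardB.
have [AB0|/set0Pn[a /setDP[Aa nBa]]] := eqVneq (A :\: B) set0.
  suff -> : A = B by exact: diag.
  by apply/eqP; rewrite eqEcard -setD_eq0 AB0 eqxx cardA cardB leqnn.
pose A' := A :\ a.
have cardA' : #|A'| = k by have := cardsD1 a A; rewrite Aa cardA => -[].
have nA'a : a \notin A' by rewrite !inE eqxx.
have sumL : (\sum_(c in B) transport X A' (B :\ c)) * 'C(n, k) = k.+1 * #|X|.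
  rewrite big_distrl /= -cardB -sum_nat_const; apply: eq_bigr => c Bc.
  by apply: eqX => //; have := cardsD1 c B; rewrite Bc cardB => -[].
(* For [c] in [B], the set [c |: A'] has fewer points outside [B] than [A] has. For [c] outside [B],
   transposing [a] and [c] preserves [B] and gives back [A]. *)
have sumR : (\sum_(c in ~: A') transport X (c |: A') B) * 'C(n, k.+1) =
    #|~: A' :&: B| * #|X| +
    #|~: A' :\: B| * (transport X A B * 'C(n, k.+1)).
  rewrite big_distrl (big_setID B) /=; congr (_ + _).
    rewrite -sum_nat_const; apply: eq_bigr => c; rewrite !inE => /andP[nA'c Bc].
    apply: IH => //; last by rewrite cardsU1 !inE nA'c cardA'.
    rewrite ltnS in leAB; apply: leq_trans leAB; apply: proper_card; apply/properP; split.
      apply/subsetP=> d; rewrite !inE => /andP[nBd]; rewrite nBd /=.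
      case: eqVneq => [dc|_ /andP[] //].
      by rewrite dc Bc in nBd.
    exists a; rewrite !inE ?Aa ?nBa // eqxx orbF; case: eqVneq => //= ac.
    by rewrite ac Bc in nBa.
  rewrite -sum_nat_const; apply: eq_bigr => c; rewrite inE => /andP[nBc].
  rewrite inE => nA'c; congr (_ * _).
  have eqB : (a \in B) = (c \in B) by rewrite (negbTE nBa) (negbTE nBc).
  have [<- _] := transport_tperm (c |: A') normX eqB.
  congr transport; rewrite imsetU1 tpermR imset_tperm_id ?setD1K //.
  by rewrite (negbTE nA'a) (negbTE nA'c).
have := mul_bin_left n k; have := sum_transport_shift X A' B.
have : #|~: A' :&: B| + #|~: A' :\: B| = n - k by rewrite cardsID cardsCs setCK cardA'.
have : 0 < #|~: A' :\: B|.
  by apply/card_gt0P; exists a; rewrite !inE nBa eqxx.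
have : 0 < 'C(n, k) by rewrite bin_gt0 -cardA' max_card.
move: sumL sumR; set S := \sum_(c in B) _; set Y := transport X A B * _.
move=> + + Cgt0 outgt0 cardE eqS; rewrite -eqS => sumL sumR eqC.
have : (#|~: A' :&: B| * #|X| + #|~: A' :\: B| * Y) * 'C(n, k) =
    (n - k) * #|X| * 'C(n, k).
  by rewrite -sumR mulnAC sumL mulnAC eqC mulnAC.
move/eqP; rewrite eqn_pmul2r // -cardE mulnDl eqn_add2l.
by rewrite eqn_pmul2l // => /eqP.
Qed.

(** * Fixed sets and cycles *)

Lemma prodr_1D_subsets (R : comNzSemiRingType) (I : finType) (P : {set I})
    (F : I -> R) :
  (\prod_(i in P) (1 + F i) = \sum_(J : {set I} | J \subset P) \prod_(i in J) F i)%R.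
Proof.
rewrite big_mkcond /=.
(* The summand 0 outside [P] kills the terms of the expansion indexed by sets not contained in
   [P]. *)
rewrite (eq_bigr (fun i => (if i \in P then F i else 0) + 1)%R); last first.
  by move=> i _; case: ifP; rewrite ?add0r // addrC.
rewrite bigA_distr [RHS]big_mkcond /=; apply: eq_bigr => J _.
case: ifP => [sJP|/negbT/subsetPn[i Ji nPi]].
  rewrite [RHS]big_mkcond /=; apply: eq_bigr => i _.
  by case: ifP => // Ji; rewrite (subsetP sJP).
by rewrite (bigD1 i) //= Ji (negbTE nPi) mul0r.
Qed.

Lemma porbits_trivIset (T : finType) (x : {perm T}) : trivIset (porbits x).
Proof.
apply/trivIsetP=> _ _ /imsetP[a _ ->] /imsetP[b _ ->]; apply: contraR.
case/pred0Pn=> c /andP[/= ca cb].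
by rewrite -(eqP (_ : porbit x c == porbit x a)) eq_porbit_mem.
Qed.

Lemma imset_porbits (T : finType) (x : {perm T}) (C : {set T}) :
  C \in porbits x -> x @: C = C.
Proof.
case/imsetP=> a _ ->; apply/eqP.
rewrite eqEcard card_imset ?leqnn ?andbT; last exact: perm_inj.
apply/subsetP=> _ /imsetP[b ba ->]; rewrite -eq_porbit_mem.
by have := porbit_perm x 1 b; rewrite expg1 => ->; rewrite eq_porbit_mem.
Qed.

Lemma porbit_subset (T : finType) (x : {perm T}) (A : {set T}) (a : T) :
  x @: A = A -> a \in A -> porbit x a \subset A.
Proof.
move=> fixA Aa; apply/subsetP=> _ /porbitP[i ->]; elim: i => [|i IH].
  by rewrite perm1.
by rewrite expgSr permM -fixA imset_f.
Qed.

(** The fixed sets are the unions of cycles, so [cover] is a bijection from the sets of cycles of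
    total size [k] to the fixed [k]-subsets. *)
Lemma coef_prod_porbits (T : finType) (x : {perm T}) (k : nat) :
  ((\prod_(C in porbits x) (1 + 'X^#|C|) : {poly nat})`_k)%R = fixed_sets x k.
Proof.
rewrite prodr_1D_subsets coef_sum.
under eq_bigr do rewrite prodrXr coefXn.
(* A set of cycles is recovered from its union, which makes [cover] injective. *)
have sub_of (J : {set {set T}}) : J \subset porbits x ->
    [set C in porbits x | C \subset cover J] = J.
  move=> sJ; apply/setP=> C; rewrite !inE; apply/andP/idP=> [[xC sC]|JC].
    have [a Ca] : exists a, a \in C.
      by case/imsetP: xC => a _ ->; exists a; exact: porbit_id.
    have /bigcupP[D JD Da] := subsetP sC _ Ca.
    suff -> : C = D by [].
    apply: contraTeq Da => nCD; have := trivIsetP (porbits_trivIset x) C D xC.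
    by move=> /(_ (subsetP sJ _ JD) nCD)/disjointFr ->.
  by split; [exact: (subsetP sJ) | exact: bigcup_sup].
pose Js := [set J : {set {set T}} | (J \subset porbits x) &&
  (k == \sum_(C in J) #|C|)].
have -> : fixed_sets x k = #|@cover T @: Js|.
  congr #|pred_of_set _|; apply/setP=> A; rewrite inE.
  apply/andP/imsetP=> [[/eqP cardA /eqP fixA]|[J]].
    set J := [set C in porbits x | C \subset A].
    have sJ : J \subset porbits x by apply/subsetP=> C; rewrite inE => /andP[].
    have covA : A = cover J.
      apply/eqP; rewrite eqEsubset; apply/andP; split; apply/subsetP=> a.
        move=> Aa; apply/bigcupP; exists (porbit x a); last exact: porbit_id.
        by rewrite inE imset_f ?porbit_subset.
      by case/bigcupP=> C; rewrite inE => /andP[_ /subsetP]; apply.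
    exists J => //; rewrite inE sJ -cardA covA eq_sym.
    exact: trivIsetS sJ (porbits_trivIset x).
  rewrite inE => /andP[sJ /eqP ->] ->; split.
    by apply/eqP/esym/eqP; exact: trivIsetS sJ (porbits_trivIset x).
  rewrite imset_cover; apply/eqP/eq_bigr=> C JC.
  by rewrite imset_porbits // (subsetP sJ).
rewrite card_in_imset; last first.
  by move=> J K; rewrite !inE => /andP[sJ _] /andP[sK _] eqJK; rewrite -(sub_of J) // eqJK sub_of.
rewrite /Js -sum1_card big_mkcond [RHS]big_mkcond /=; apply: eq_bigr => J _.
rewrite inE; case: (_ \subset _) => //=; by case: (_ == _).
Qed.

(** * Subset sums and powers of two *)

(* Generating function of the sums of the sublists of [s]. *)
Definition subset_sums (s : seq nat) : {poly nat} :=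
  (\prod_(l <- s) (1 + 'X^l))%R.

Definition nb_subset_sums (s : seq nat) (m : nat) : nat := ((subset_sums s)`_m)%R.

Lemma nb_subset_sums_cons (l : nat) (s : seq nat) (m : nat) :
  nb_subset_sums (l :: s) m = 
  nb_subset_sums s m + (if m < l then 0 else nb_subset_sums s (m - l)).
Proof. by rewrite /nb_subset_sums /subset_sums big_cons mulrDl mul1r coefD coefXnM. Qed.

Lemma nb_subset_sums_lt (s : seq nat) (m d : nat) : d < m ->
  nb_subset_sums s d = nb_subset_sums [seq l <- s | l < m] d.
Proof.
elim: s d => // l s IH d ltdm /=; rewrite nb_subset_sums_cons.
case: (ltnP l m) => ltlm; first rewrite nb_subset_sums_cons -!IH //.
  exact: leq_ltn_trans (leq_subr _ _) ltdm.
by rewrite (_ : d < l) ?addn0 ?IH //; lia.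
Qed.

Lemma nb_subset_sums0 (s : seq nat) : 0 \notin s -> nb_subset_sums s 0 = 1.
Proof.
elim: s => [|l s IH]; first by rewrite /nb_subset_sums /subset_sums big_nil coef1.
rewrite inE negb_or eq_sym -lt0n => /andP[l_gt0 s_gt0].
by rewrite nb_subset_sums_cons l_gt0 IH.
Qed.

(** Entries above [m] cannot contribute, and an entry equal to [m] contributes only alone, all
    entries being positive. *)
Lemma nb_subset_sumsE (s : seq nat) (m : nat) : 0 \notin s ->
  nb_subset_sums s m = 
  nb_subset_sums [seq l <- s | l < m] m + count_mem m s.
Proof.
elim: s => [|l s IH] /=; first by rewrite addn0.
rewrite inE negb_or => /andP[l_gt0 s_gt0].
rewrite nb_subset_sums_cons IH //; case: (ltngtP l m) => [ltlm|ltml|->] /=.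
- rewrite nb_subset_sums_cons (ltnNge m l) ltnW //= add0n addnAC.
  by rewrite (@nb_subset_sums_lt s m (m - l)) //; lia.
- by rewrite addn0.
- by rewrite subnn nb_subset_sums0 // addnAC addnA.
Qed.

(** Uniqueness of binary expansions: the factor [1 + 'X^(2 ^ e)] doubles the length of the geometric
    sum. *)
Lemma subset_sums_expn2 (e : nat) :
  subset_sums [seq 2 ^ i | i <- iota 0 e] = (\sum_(i < 2 ^ e) 'X^i)%R.
Proof.
elim: e => [|e IH]; first by rewrite /subset_sums big_nil big_ord1.
rewrite -[e.+1]addn1 iotaD map_cat /subset_sums big_cat big_seq1 -/(subset_sums _) IH.
rewrite add0n expnD muln2 -addnn big_split_ord /= mulrDr mulr1.
by congr (_ + _)%R; rewrite big_distrl; apply: eq_bigr => i _; rewrite /= exprD mulrC.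
Qed.

(** [up_log 2 m] is the only possible exponent; the test is false at 0. *)
Definition is_expn2 (m : nat) : bool := m == 2 ^ up_log 2 m.

Lemma is_expn2P (m : nat) : reflect (exists i, m = 2 ^ i) (is_expn2 m).
Proof.
apply: (iffP eqP) => [->|[i ->]]; last by rewrite up_expnK.
by exists (up_log 2 m).
Qed.

(** The entries below [m] are [2 ^ 0, ..., 2 ^ (e - 1)], whose subset sums are the numbers below
    [2 ^ e]. As [m <= 2 ^ e], only [m = 2 ^ e] is missed. *)
Lemma nb_subset_sums_small (s : seq nat) (m : nat) : 0 \notin s -> 0 < m ->
    (forall l, 0 < l < m -> count_mem l s = is_expn2 l) ->
  nb_subset_sums [seq l <- s | l < m] m = ~~ is_expn2 m.
Proof.
move=> s_gt0 m_gt0 cnt; set e := up_log 2 m.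
have le_me : m <= 2 ^ e by exact: up_logP.
have lt_em i : (2 ^ i < m) = (i < e).
  apply/idP/idP => [lt_im|lt_ie]; first by rewrite -(ltn_exp2l _ _ (ltnSn 1)) (leq_trans lt_im).
  by rewrite ltnNge; apply/negP => /(up_log_min (ltnSn 1)); rewrite leqNgt lt_ie.
have /(perm_big _) : perm_eq [seq l <- s | l < m] [seq 2 ^ i | i <- iota 0 e].
  apply/allP=> l _ /=; rewrite count_filter count_uniq_mem; last first.
    by rewrite map_inj_uniq ?iota_uniq //; exact: expnI.
  have -> : (l \in [seq 2 ^ i | i <- iota 0 e]) = (l < m) && is_expn2 l.
    apply/mapP/andP=> [[i]|[lt_lm /is_expn2P[i li]]].
      by rewrite mem_iota => /= lt_ie ->; split; [rewrite lt_em | apply/is_expn2P; exists i].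
    by exists i; rewrite // mem_iota /= -lt_em -li.
  case: (ltnP l m) => lt_lm /=; last first.
    rewrite (@eq_in_count _ _ pred0) ?count_pred0 // => i _ /=.
    by case: eqP => //= ->; rewrite ltnNge lt_lm.
  rewrite (@eq_in_count _ _ (pred1 l)); last by move=> i _ /=; case: eqP => // ->.
  case: l lt_lm => [|l] lt_lm; last by rewrite cnt.
  by rewrite (count_memPn s_gt0) /is_expn2.
rewrite /nb_subset_sums /subset_sums => ->; rewrite -/(subset_sums _) subset_sums_expn2 coef_sum.
under eq_bigr do rewrite coefXn.
rewrite /is_expn2 -/e; case: ltngtP le_me => // [lt_me|->] _.
  by rewrite (bigD1 (Ordinal lt_me)) //= eqxx big1 // => i; rewrite eq_sym -val_eqE /= => /negbTE ->.
by rewrite big1 // => i _; rewrite gtn_eqF.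
Qed.

(** By strong induction the coefficient at [m > 0] is [~~ is_expn2 m] plus the multiplicity of
    [m]. *)
Lemma nb_subset_sums_eq1 (s : seq nat) (k : nat) : 0 \notin s ->
  (forall m, m <= k -> nb_subset_sums s m = 1) <->
  (forall m, 0 < m <= k -> count_mem m s = is_expn2 m).
Proof.
move=> s_gt0; split=> [coef1 m | cnt [|m] le_mk].
- have [n] := ubnP m; elim: n m => // n IH m lt_mn /andP[m_gt0 le_mk].
  have := coef1 m le_mk; rewrite nb_subset_sumsE //.
  rewrite nb_subset_sums_small // => [|l /andP[l_gt0 lt_lm]].
    by case: (is_expn2 m) => /=; lia.
  by apply: IH; [exact: leq_trans lt_lm lt_mn | rewrite l_gt0 ltnW ?(leq_trans lt_lm)].
- exact: nb_subset_sums0.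
- rewrite nb_subset_sumsE // nb_subset_sums_small // => [|l /andP[l_gt0 lt_lm]].
    by rewrite cnt //; case: is_expn2.
  by rewrite cnt // l_gt0 ltnW ?(leq_trans lt_lm).
Qed.

(** * Equidistribution in terms of fixed sets *)

Lemma equidistributed_fixed_sets (T : finType) (x : {perm T}) (k : nat) :
    k <= #|T| -> equidistributed (x ^: [set: {perm T}])%g k ->
  fixed_sets x k = 1.
Proof.
move=> le_kT eqX; have := sum_transport_diag x k.
move/(congr1 (muln^~ 'C(#|T|, k))); rewrite big_distrl /=.
under eq_bigr => A /eqP cardA do rewrite eqX //.
rewrite sum_nat_const -card_draws -cardsE mulnC mulnAC.
move/eqP; rewrite -[X in X == _]muln1 eqn_pmul2l => [/eqP //|].
rewrite muln_gt0 card_draws bin_gt0 le_kT andbT.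
by apply/card_gt0P; exists x; exact: class_refl.
Qed.

(** At [k.+1] the bound reads [2k < #|T|], just what the descent to [k] requires. *)
Lemma equidistributed_iff (T : finType) (x : {perm T}) (k : nat) :
    k.*2 <= #|T|.+1 ->
  equidistributed (x ^: [set: {perm T}])%g k <->
  (forall i, i <= k -> fixed_sets x i = 1).
Proof.
elim: k => [|k IH] le_kT.
  split=> _; last exact: equidistributed0.
  by move=> i; rewrite leqn0 => /eqP ->; apply/equidistributed_fixed_sets/equidistributed0.
have normX : [set: {perm T}] \subset 'N((x ^: [set: {perm T}])%g)%g by exact: class_norm.
split=> [eqX i|fix1].
  rewrite leq_eqVlt => /predU1P[->|]; first by apply: equidistributed_fixed_sets => //; lia.
  rewrite ltnS; apply: (proj1 (IH _)); first by lia.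
  by apply: equidistributed_pred eqX => //; lia.
apply: equidistributed_succ (fix1 _ (leqnn _)); apply/IH; first by lia.
by move=> i le_ik; apply: fix1; exact: leqW.
Qed.

(** * Factorizations through the Young subgroup *)

Lemma mem_young (n k : nat) (y : 'S_n) :
  (y \in young n k) = (y @: [set i : 'I_n | i < k] == [set i : 'I_n | i < k]).
Proof.
set S := [set i : 'I_n | i < k]; rewrite /young -/S.
have -> : [set i : 'I_n | k <= i] = ~: S by apply/setP=> i; rewrite !inE -leqNgt.
apply/mulsgP/eqP=> [[s t] | fixS].
  rewrite !inE => sS tS ->; rewrite imset_permM (im_perm_on sS).
  rewrite (eq_in_imset (g := id)) ?imset_id // => i Si.
  by rewrite (out_perm tS) // in_setC Si.
have Ny : y \in 'N(S | 'P)%g.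
  by apply/astabsP=> i; rewrite /= apermE -{1}fixS mem_imset //; exact: perm_inj.
(* The factor in [Sym S] is the restriction of [y] to [S]; the remaining factor fixes [S]
   pointwise. *)
have rS : restr_perm S y \in Sym S by rewrite inE restr_perm_on.
exists (restr_perm S y) ((restr_perm S y)^-1 * y)%g => //; last by rewrite mulKVg.
rewrite inE; apply/subsetP=> i; rewrite !inE; apply: contraNN => lt_ik.
have Si : (restr_perm S y)^-1%g i \in S.
  by rewrite -(perm_closed _ (restr_perm_on S y)) permKV inE.
by rewrite permM -(restr_permE Ny Si) permKV.
Qed.

(** The first factor [a] determines the second, [a^-1 * g], which lies in the stabilizer of [S]
    exactly when [a] sends [g^-1 @: S] to [S]. *)
Lemma card_factorizations (n k : nat) (X : {set 'S_n}) (g : 'S_n) :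
  let S := [set i : 'I_n | i < k] in
  #|[set ab in setX X (young n k) | g == (ab.1 * ab.2)%g]| =
  transport X (g^-1%g @: S) S.
Proof.
move=> S; set F := [set ab in _ | _].
have injF : {in F &, injective (fun ab : 'S_n * 'S_n => ab.1)}.
  move=> [a b] [a' b']; rewrite !inE /= => /andP[_ /eqP gab] /andP[_ /eqP gab'] eqa.
  by move: gab; rewrite gab' -eqa => /mulgI ->.
rewrite -(card_in_imset injF); congr #|pred_of_set _|; apply/setP=> a.
have aE b : g = (a * b)%g -> (a @: (g^-1%g @: S) == S) = (b \in young n k).
  move=> ->; rewrite mem_young -imset_permM invMg mulgKV imset_perm_eq.
  by rewrite eq_sym.
rewrite inE; apply/imsetP/andP=> [[[a' b]]|[Xa fixS]].
  rewrite !inE /= => /andP[/andP[Xa Yb] /eqP gab] eqa.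
  by rewrite -eqa in Xa gab; rewrite (aE b).
exists (a, a^-1 * g)%g; rewrite //= !inE /= Xa mulKVg eqxx andbT -aE ?mulKVg //.
Qed.

(** As [g] varies, [g^-1 @: S] runs over all [k]-subsets; conjugation then replaces the target [S]
    by any [k]-subset. *)
Lemma fold_factorization_young (n k : nat) (x : 'S_n) : k <= n ->
  (exists r : nat,
      0 < r /\ fold_factorization r (x ^: [set: 'S_n])%g (young n k)) <->
  equidistributed (x ^: [set: 'S_n])%g k.
Proof.
move=> le_kn; set X := (x ^: _)%g; pose S := [set i : 'I_n | i < k].
have normX : [set: 'S_n] \subset 'N(X)%g by exact: class_norm.
have X_gt0 : 0 < #|X| by apply/card_gt0P; exists x; exact: class_refl.
have cardS : #|S| = k.
  by rewrite -sum1dep_card -(big_ord_widen n (fun=> 1) le_kn) sum1_card card_ord.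
split=> [[r [_ facX]] A B cardA cardB|eqX].
  have trS (C : {set 'I_n}) : #|C| = k -> transport X C S = r.
    move=> cardC; have [|s <-] := @perm_transitive_sets _ S C; first by rewrite cardS.
    by rewrite -(facX s^-1%g) card_factorizations invgK.
  have trE (C D : {set 'I_n}) : #|C| = k -> #|D| = k -> transport X C D = r.
    move=> cardC cardD; have [|s <-] := @perm_transitive_sets _ S D; first by rewrite cardS.
    rewrite -(trS (s^-1%g @: C)); last by rewrite card_imset //; exact: perm_inj.
    by rewrite -[RHS](transport_conj s) // -imset_permM mulVg imset_perm1.
  (* The value of [r] comes from summing over all targets [C]: each element of [X] sends [A] to
     exactly one of them. *)
  rewrite trE // mulnC -card_draws -sum_nat_const.
  rewrite (eq_bigr (transport X A)) => [|C]; last by rewrite inE => /eqP cardC; rewrite trE.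
  under eq_bigr do rewrite transportE; rewrite exchange_big -sum1_card /=.
  apply: eq_bigr => a _; rewrite (bigD1 (a @: A)) /= ?eqxx; last first.
    by rewrite inE card_imset ?cardA //; exact: perm_inj.
  by rewrite big1 // => C /andP[_ /negbTE]; rewrite eq_sym => ->.
exists (transport X S S); split.
  by move: X_gt0; rewrite -(eqX S S cardS cardS) muln_gt0 => /andP[].
move=> g; rewrite card_factorizations -/S.
have C_gt0 : 0 < 'C(#|'I_n|, k) by rewrite card_ord bin_gt0.
apply/eqP; rewrite -(eqn_pmul2r C_gt0) !eqX // card_imset //; exact: perm_inj.
Qed.

Theorem theorem1p1 (n k j : nat) (hn : 0 < n) (hk : 0 < k) (hnk : 2 * k < n)
    (hj : 2 ^ j <= k < 2 ^ j.+1) (x : 'S_n) :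
  (exists r : nat,
      0 < r /\ fold_factorization r (x ^: [set: 'S_n])%g (young n k))
  <->
  (forall i : nat, i <= j -> count_mem (2 ^ i) (cycle_type x) = 1) /\
  (forall l : nat, l \in cycle_type x ->
     (forall i : nat, i <= j -> l <> 2 ^ i) -> k.+1 <= l).
Proof.
have le_kn : k <= n by lia.
have ct_gt0 : 0 \notin cycle_type x.
  rewrite mem_sort; apply/imageP=> -[_ /imsetP[i _ ->]] /esym/eqP.
  by rewrite (negbTE (card_porbit_neq0 x i)).
have fixE i : fixed_sets x i = nb_subset_sums (cycle_type x) i.
  rewrite -coef_prod_porbits /nb_subset_sums /subset_sums.
  by rewrite (perm_big _ (permEl (perm_sort _ _))) big_image.
have [lt_jk lt_kj] := andP hj.
rewrite (fold_factorization_young x le_kn) equidistributed_iff ?card_ord; last by lia.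
have -> : (forall i, i <= k -> fixed_sets x i = 1) <->
    (forall i, i <= k -> nb_subset_sums (cycle_type x) i = 1).
  by split=> H i; [rewrite -fixE|rewrite fixE]; exact: H.
rewrite nb_subset_sums_eq1 //.
split=> [cnt|[cnt1 cnt0] m /andP[m_gt0 le_mk]].
  split=> [i le_ij|l ct_l not_exp].
    rewrite cnt; first by rewrite (introT (is_expn2P _)) //; exists i.
    by rewrite expn_gt0 /= (leq_trans _ lt_jk) // leq_exp2l.
  rewrite ltnNge; apply/negP=> le_lk.
  have l_gt0 : 0 < l by rewrite lt0n; apply: contraNneq ct_gt0 => <-.
  move: ct_l; rewrite -has_pred1 has_count cnt ?l_gt0 // lt0b => /is_expn2P[i li].
  (* From [2 ^ i <= k < 2 ^ j.+1] follows [i <= j]. *)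
  apply: (not_exp i) => //; rewrite -ltnS -(ltn_exp2l _ _ (ltnSn 1)) -li.
  exact: leq_ltn_trans lt_kj.
have [/is_expn2P[i mi]|not_exp] := boolP (is_expn2 m).
  rewrite mi cnt1 // -ltnS -(ltn_exp2l _ _ (ltnSn 1)) -mi.
  exact: leq_ltn_trans lt_kj.
apply/count_memPn/negP=> ct_m; have := cnt0 m ct_m.
rewrite ltnNge le_mk => H; have // : false.
by apply: H => i _ mi; case/is_expn2P: not_exp; exists i.
Qed.
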